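(* Let $S_1,S_2$ be the discrete Dirichlet-to-Neumann operators on the interface space $V_\Gamma$ described in the context, with smallest eigenvalues $\underline{\lambda}_1,\underline{\lambda}_2$ and largest eigenvalues $\overline{\lambda}_1,\overline{\lambda}_2$, respectively. Assume that there are constants $0<s\le 1$ and $t\ge 1$, independent of the grid size $h$, such that $$s(S_1v,v)\le (S_2v,v)\le t(S_1v,v)\qquad\text{for all } v\in V_\Gamma,$$ and that $$0<\gamma_1\le\min\{\underline{\lambda}_1,\underline{\lambda}_2\},\qquad \gamma_2\ge 3\max\{\overline{\lambda}_1,\overline{\lambda}_2\}.$$ Let $$R=\theta I-(1-\theta)T,\qquad T=(S_2-\gamma_1)(\gamma_2+S_2)^{-1}(\gamma_2-S_1)(\gamma_1+S_1)^{-1}.$$ If $\theta=\dfrac{2t-1}{2t+1}$, then the spectrum of the domain decomposition reduction operator $R$ is bounded, independently of $h$: $$\sigma(R)\subset\left[-\frac{2t-1}{2t+1},\ \frac{2t-1}{2t+1}\right].$$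
   Context: A domain $\Omega$ is split by an interface $\Gamma$ into two nonoverlapping subdomains $\Omega_1,\Omega_2$. $V_i$ denotes the restriction to $\Omega_i$ of a finite element space in $H_0^1(\Omega)$ on a quasi-uniform mesh of size $h$, $V_\Gamma=V_1|_\Gamma=V_2|_\Gamma$ (a finite-dimensional real space), $(\cdot,\cdot)$ is the $L^2(\Gamma)$ inner product on $V_\Gamma$, and $a_i(u,v)=\int_{\Omega_i}\nabla u\cdot\nabla v\,dx$. The discrete Dirichlet-to-Neumann operator $S_i:V_\Gamma\to V_\Gamma$ is defined by $(S_i\varphi,\psi)=a_i(H_i\varphi,H_i\psi)$, where $H_i\varphi\in V_i$ is the discrete harmonic extension of $\varphi$ (equal to $\varphi$ on $\Gamma$ and $a_i$-orthogonal to all functions of $V_i$ vanishing on $\Gamma$). $S_1,S_2$ are symmetric and positive definite with respect to $(\cdot,\cdot)$. A scalar $\gamma$ in an operator expression means $\gamma I$. $R$ is the error reduction operator of the Robin-Robin domain decomposition iteration with parameters $\gamma_1,\gamma_2,\theta$: starting from $g_1^m\in V_\Gamma$, solve $a_1(u^m,v)+\gamma_1(u^m,v)=(f,v)_{\Omega_1}+(g_1^m,v)$ for all $v\in V_1$; set $g_2^m=-g_1^m+(\gamma_1+\gamma_2)u^m$ on $\Gamma$; solve $a_2(w^m,v)+\gamma_2(w^m,v)=(f,v)_{\Omega_2}+(g_2^m,v)$ for all $v\in V_2$; set $\tilde g_1^m=-g_2^m+(\gamma_1+\gamma_2)w^m$ on $\Gamma$ and $g_1^{m+1}=\theta g_1^m+(1-\theta)\tilde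 g_1^m$. The interface error $\varepsilon_1^m=g_1-g_1^m$ satisfies $\varepsilon_1^{m+1}=R\,\varepsilon_1^m$. *)

(* Defs.v *)
From HB Require Import structures.
From mathcomp Require Import all_boot all_order all_algebra.
From mathcomp Require Import all_classical all_reals all_analysis.
From mathcomp Require Export complex.
Set Implicit Arguments.
Unset Strict Implicit.
Unset Printing Implicit Defensive.
Import Order.TTheory GRing.Theory Num.Theory.
Import numFieldNormedType.Exports.
Import passmx.
Local Open Scope classical_set_scope.
Local Open Scope ring_scope.

Section Geometry.
Context (R : realType) (d : nat).
Notation pt := 'rV[R]_d.

(* R^d with its Borel sigma-algebra. *)
Definition borel := g_sigma_algebraType (@open pt).

Definition dot (x y : pt) : R := \sum_(k < d) x ord0 k * y ord0 k.

(* The library's norm on row vectors is the sup norm. *)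
Definition enorm (x : pt) : R := Num.sqrt (dot x x).

Definition partial (k : 'I_d) (u : pt -> R) (x : pt) : R :=
  'D_(delta_mx ord0 k) u x.

(* Where a partial derivative does not exist, 'D has a default value; for the
   Lipschitz functions below such points form a null set. *)
Definition grad (u : pt -> R) (x : pt) : pt := \row_k partial k u x.

(* Boxes determine the measure uniquely. *)
Definition is_lebesgue (vol : {measure set borel -> \bar R}) : Prop :=
  forall a b : pt, (forall k, a ord0 k <= b ord0 k) ->
    vol [set x | forall k : 'I_d, a ord0 k < x ord0 k <= b ord0 k] =
    (\prod_(k < d) (b ord0 k - a ord0 k))%:E.

(* Volume of the Euclidean unit ball of R^m, by
   v_0 = 1, v_1 = 2, v_(m+2) = 2 pi / (m + 2) v_m. *)
Fixpoint unit_ball_volume (m : nat) : R :=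
  match m with
  | 0 => 1
  | 1 => 2
  | m'.+2 => 2 * pi / m%:R * unit_ball_volume m'
  end.

Definition diam (U : set pt) : \bar R :=
  ereal_sup [set r | exists x y, [/\ U x, U y & r = (enorm (x - y))%:E]].

(* The empty set must cost 0 also when m = 0. *)
Definition hausdorff_cost (m : nat) (U : set pt) : \bar R :=
  if U == set0 then 0%E
  else (unit_ball_volume m * (fine (diam U) / 2) ^+ m)%:E.

Definition hausdorff_pre (m : nat) (delta : R) (A : set pt) : \bar R :=
  ereal_inf [set r | exists U : nat -> set pt,
    [/\ A `<=` \bigcup_k U k,
        (forall k, (diam (U k) <= delta%:E)%E)
      & r = (\sum_(0 <= k <oo) hausdorff_cost m (U k))%E]].

(* m-dimensional Hausdorff measure, normalized to agree with m-dimensional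
   surface area. *)
Definition hausdorff (m : nat) (A : set pt) : \bar R :=
  ereal_sup [set hausdorff_pre m delta A | delta in [set e : R | 0 < e]].

Definition is_surface_area (area : {measure set borel -> \bar R}) : Prop :=
  forall A : set borel, measurable A -> area A = hausdorff d.-1 A.

Definition is_domain (Omega : set pt) : Prop :=
  [/\ open Omega, connected Omega, Omega !=set0 &
      exists M : R, forall x, Omega x -> enorm x <= M].

(* The last two clauses say that Gamma is a (d-1)-dimensional hypersurface as
   far as L^2(Gamma) is concerned. *)
Definition is_splitting (area : {measure set borel -> \bar R})
    (Omega Omega1 Omega2 Gamma : set pt) : Prop :=
  [/\ [/\ open Omega1, Omega1 !=set0, open Omega2 & Omega2 !=set0],
      Omega1 `&` Omega2 = set0
        /\ Omega1 `|` Omega2 = Omega `\` Gamma,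
      Gamma = Omega `&` (closure Omega1 `&` closure Omega2),
      (area Gamma < +oo)%E
    & forall U : set pt, open U -> Gamma `&` U !=set0 ->
        (0 < area (Gamma `&` U))%E].

(* Elements may be curved; neighbouring elements only share boundary points. *)
Definition is_mesh (Omega : set pt) (n : nat) (K : 'I_n -> set pt) : Prop :=
  [/\ forall i, [/\ compact (K i), (interior (K i)) !=set0
                  & K i = closure (interior (K i))],
      forall i j, i != j -> interior (K i) `&` interior (K j) = set0
    & \bigcup_i K i = closure Omega].

(* A family of meshes of sizes h is quasi-uniform when this holds with one c > 0
   for all members of the family. *)
Definition is_quasi_uniform (c h : R) (n : nat) (K : 'I_n -> set pt) : Prop :=
  forall i, (forall x y, K i x -> K i y -> enorm (x - y) <= h)
    /\ exists x, forall y, enorm (y - x) <= c * h -> K i y.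

Definition fe_span (N : nat) (b : 'I_N -> pt -> R) : set (pt -> R) :=
  [set u | exists a : 'I_N -> R, u = fun x => \sum_i a i * b i x].

(* A finite element space on the mesh K, spanned by the shape functions b,
   each extended by 0 to R^d and C^1 inside every element. A Lipschitz function
   that vanishes outside the bounded open set Omega lies in H^1_0(Omega). *)
Definition is_fe_space (Omega : set pt) (n : nat) (K : 'I_n -> set pt)
    (N : nat) (b : 'I_N -> pt -> R) : Prop :=
  forall j,
  [/\ exists L : R, forall x y, `|b j x - b j y| <= L * enorm (x - y),
      forall x, ~ Omega x -> b j x = 0
    & forall i x, interior (K i) x -> forall k,
        derivable (b j) x (delta_mx ord0 k)
        /\ {for x, continuous (partial k (b j))}].

(* Restrictions to D, encoded as functions that are 0 outside D. *)
Definition fe_restr (N : nat) (b : 'I_N -> pt -> R) (D : set pt) :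
    set (pt -> R) :=
  [set u \_ D | u in fe_span b].

(* tr identifies the abstract finite-dimensional space VG with the space of
   restrictions to Gamma of finite element functions. *)
Definition is_trace_space (N : nat) (b : 'I_N -> pt -> R) (Gamma : set pt)
    (VG : vectType R) (tr : VG -> pt -> R) : Prop :=
  [/\ forall (a : R) (phi psi : VG) x,
        tr (a *: phi + psi) x = a * tr phi x + tr psi x,
      injective tr
    & range tr = fe_restr b Gamma].

Definition l2 (area : {measure set borel -> \bar R}) (Gamma : set pt)
    (f g : pt -> R) : R :=
  \int[area]_(x in Gamma) (f x * g x).

Definition dirichlet (vol : {measure set borel -> \bar R}) (Omegai : set pt)
    (u v : pt -> R) : R :=
  \int[vol]_(x in Omegai) dot (grad u x) (grad v x).

Definition is_harmonic_extension (vol : {measure set borel -> \bar R})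
    (Omegai Gamma : set pt) (N : nat) (b : 'I_N -> pt -> R)
    (g u : pt -> R) : Prop :=
  [/\ fe_restr b (closure Omegai) u,
      forall x, Gamma x -> u x = g x
    & forall v, fe_restr b (closure Omegai) v ->
        (forall x, Gamma x -> v x = 0) -> dirichlet vol Omegai u v = 0].

Definition is_DtN (vol area : {measure set borel -> \bar R})
    (Omegai Gamma : set pt) (N : nat) (b : 'I_N -> pt -> R)
    (VG : vectType R) (tr : VG -> pt -> R) (S : 'End(VG)) : Prop :=
  exists H : VG -> pt -> R,
    (forall phi, is_harmonic_extension vol Omegai Gamma b (tr phi) (H phi))
    /\ forall phi psi,
         l2 area Gamma (tr (S phi)) (tr psi)
         = dirichlet vol Omegai (H phi) (H psi).

End Geometry.

Section Operators.
Context (R : realType) (V : vectType R).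
Implicit Types (A S : 'End(V)).

Definition is_smallest_eigenvalue S (l : R) : Prop :=
  leigenvalue S l /\ forall m, leigenvalue S m -> l <= m.

Definition is_largest_eigenvalue S (l : R) : Prop :=
  leigenvalue S l /\ forall m, leigenvalue S m -> m <= l.

(* Complex spectrum: the operators of interest are not symmetric, so that their
   spectrum is real is part of the assertion. *)
Definition spectrum A : set R[i] :=
  [set z | eigenvalue (map_mx (real_complex R)
                         (mxof (vbasis {:V}) (vbasis {:V}) A)) z].

(* The inverses are two-sided when the operators inverted are bijective, as they
   are for S1, S2 positive definite and gamma1, gamma2 > 0. *)
Definition robin_T S1 S2 (gamma1 gamma2 : R) : 'End(V) :=
  ((S2 - gamma1 *: \1) \o (gamma2 *: \1 + S2)^-1
     \o (gamma2 *: \1 - S1) \o (gamma1 *: \1 + S1)^-1)%VF.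

Definition robin_R S1 S2 (gamma1 gamma2 theta : R) : 'End(V) :=
  (theta *: \1 - (1 - theta) *: robin_T S1 S2 gamma1 gamma2)%VF.

End Operators.

(* Main.v *)
From HB Require Import structures.
Require Import Defs.
From mathcomp Require Import all_boot all_order all_algebra.
From mathcomp Require Import all_classical all_reals all_analysis.
From mathcomp Require Import complex.
From mathcomp Require Import measurable_realfun ring lra.
Import Order.TTheory GRing.Theory Num.Theory.
Import numFieldNormedType.Exports.
Import passmx.
Local Open Scope classical_set_scope.
Local Open Scope ring_scope.
Set Implicit Arguments.
Unset Strict Implicit.
Unset Printing Implicit Defensive.

(** On the trace space, the L^2(Gamma) product is an inner product
    ([l2_inner_product]), for which S1 and S2 are self-adjoint because the
    Dirichlet form is symmetric. The hypotheses on gamma1 and gamma2 concern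
    eigenvalues; the Rayleigh bound [rayleigh_ge] turns them into the form
    inequalities 0 < S1 < gamma2 and gamma1 <= S2.

    Write T = A B with A = (S2 - gamma1)(gamma2 + S2)^-1 and
    B = (gamma2 - S1)(gamma1 + S1)^-1, and let C = B^-1. Both A and C are
    self-adjoint, being products of commuting self-adjoint operators, and C is
    positive definite. With w = B v, the equation T v = a v becomes the
    symmetric pencil A w = a C w. Hence a is real ([pencil_eigenvalue_real])
    and equals (A w, w) / (C w, w). Comparing each factor with its
    Dirichlet-to-Neumann operator gives
<<
      0 <= (A w, w) <= (S2 w, w) / gamma2 <= t (S1 w, w) / gamma2 <= t (C w, w),
>>
    where the outer bounds are the scalar inequalities
    (x - gamma1) / (gamma2 + x) <= x / gamma2 and
    x / gamma2 <= (gamma1 + x) / (gamma2 - x) read off on the spectra of S2 and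
    S1. So the spectrum of T lies in [0, t], and that of
    R = theta - (1 - theta) T in [theta - (1 - theta) t, theta]. For
    theta = (2 t - 1) / (2 t + 1) and t >= 1 the left end is at least - theta,
    since (1 - theta) t = 2 t / (2 t + 1) <= 2 theta.

    The operators are real but may a priori have complex eigenvalues, so an
    eigenvector p + i q is handled as a pair of real vectors p, q
    ([spectrumP]). *)

(** * Self-adjoint operators on a real inner product space *)

Section InnerProduct.
Context (R : realType) (V : vectType R).
Implicit Types (ip : V -> V -> R) (S A C F G : 'End(V)).

Record inner_product ip : Prop := InnerProduct {
  ip_linear : forall a u v w, ip (a *: u + v) w = a * ip u w + ip v w;
  ip_sym : forall u v, ip u v = ip v u;
  ip_gt0 : forall v, v != 0 -> 0 < ip v v }.

Definition self_adjoint ip S := forall u v, ip (S u) v = ip u (S v).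

Section Bilinear.
Context (ip : V -> V -> R) (Hip : inner_product ip).

Lemma ip0l v : ip 0 v = 0.
Proof. by have := ip_linear Hip 1 0 0 v; rewrite scaler0 addr0; lra. Qed.

Lemma ipDl u v w : ip (u + v) w = ip u w + ip v w.
Proof. by have := ip_linear Hip 1 u v w; rewrite scale1r mul1r. Qed.

Lemma ipZl a u v : ip (a *: u) v = a * ip u v.
Proof. by have := ip_linear Hip a u 0 v; rewrite addr0 ip0l addr0. Qed.

Lemma ipNl u v : ip (- u) v = - ip u v.
Proof. by rewrite -scaleN1r ipZl mulN1r. Qed.

Lemma ipBl u v w : ip (u - v) w = ip u w - ip v w.
Proof. by rewrite ipDl ipNl. Qed.

Lemma ipDr u v w : ip w (u + v) = ip w u + ip w v.
Proof. by rewrite !(ip_sym Hip w) ipDl. Qed.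

Lemma ipZr a u v : ip v (a *: u) = a * ip v u.
Proof. by rewrite !(ip_sym Hip v) ipZl. Qed.

Lemma ipNr u v : ip v (- u) = - ip v u.
Proof. by rewrite !(ip_sym Hip v) ipNl. Qed.

Lemma ip_ge0 v : 0 <= ip v v.
Proof.
by have [->|v0] := eqVneq v 0; [rewrite ip0l|exact/ltW/(ip_gt0 Hip)].
Qed.

Lemma lker0_definite F : (forall v, v != 0 -> 0 < ip (F v) v) -> lker F == 0%VS.
Proof.
move=> F_gt0; rewrite -subv0; apply/subvP => v; rewrite memv_ker memv0 => Fv.
by apply: contraLR (isT) => /F_gt0; rewrite (eqP Fv) ip0l ltxx.
Qed.

(** Writing the second argument as [G w], both sides equal [ip (F u) w]: [G]
    moves across the product and cancels against its inverse. *)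
Lemma self_adjoint_ratio F G : self_adjoint ip F -> self_adjoint ip G ->
  (forall v, F (G v) = G (F v)) -> lker G == 0%VS ->
  self_adjoint ip (F \o G^-1)%VF.
Proof.
move=> HF HG FG kG u v; rewrite !lfunE /=.
by rewrite -[in LHS](lker0_lfunVK kG v) -HG -FG (lker0_lfunVK kG) HF.
Qed.

(** The hypotheses say that A (p + i q) = (a + i b) C (p + i q). Symmetry of A
    and C equates the two evaluations of (A p, q), which leaves b times
    (C p, p) + (C q, q), a positive number. *)
Lemma pencil_eigenvalue_real A C a b p q :
  self_adjoint ip A -> self_adjoint ip C ->
  (forall v, v != 0 -> 0 < ip (C v) v) ->
  (p != 0) || (q != 0) ->
  A p = a *: C p - b *: C q -> A q = b *: C p + a *: C q -> b = 0.
Proof.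
move=> HA HC Cgt0 pq0 Ap Aq.
have Cge0 v : 0 <= ip (C v) v.
  by have [->|v0] := eqVneq v 0; [rewrite linear0 ip0l|exact/ltW/Cgt0].
have sum_gt0 : 0 < ip (C p) p + ip (C q) q.
  by case/orP: pq0 => /Cgt0 ?; [apply: ltr_pwDl|apply: ltr_wpDl].
have : b * (ip (C p) p + ip (C q) q) = 0.
  have := HA p q; rewrite Ap Aq ipBl ipDr !ipZl !ipZr.
  by rewrite -!HC; lra.
by move/eqP; rewrite mulf_eq0 (gt_eqF sum_gt0) orbF => /eqP.
Qed.

End Bilinear.

Lemma leigenvalueP S m :
  reflect (exists2 v, v != 0 & S v = m *: v) (leigenvalue S m).
Proof.
rewrite /leigenvalue /leigenspace -subv0.
apply: (iffP idP) => [/subvPn[v]|[v v0 Sv]].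
  rewrite memv_ker memv0 add_lfunE opp_lfunE subr_eq0 => /eqP Sv v0.
  by exists v => //; rewrite Sv scale_lfunE id_lfunE.
apply/subvPn; exists v; rewrite ?memv0//.
by rewrite memv_ker add_lfunE opp_lfunE scale_lfunE id_lfunE Sv subrr.
Qed.

(** A complex row eigenvector of the real matrix of [A] splits into its real and
    imaginary parts, which are the coordinates of [p] and [q]. *)
Lemma spectrumP A z : spectrum A z -> exists p q,
  [/\ (p != 0) || (q != 0),
      A p = complex.Re z *: p - complex.Im z *: q
    & A q = complex.Im z *: p + complex.Re z *: q].
Proof.
move=> /eigenvalueP[w wA w0].
pose e := vbasis {:V}.
have eB : basis_of fullv e by exact: vbasisP.
pose u := map_mx (@complex.Re R) w; pose v := map_mx (@complex.Im R) w.
have ReD : {morph @complex.Re R : x y / x + y} by case=> ? ? [].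
have ImD : {morph @complex.Im R : x y / x + y} by case=> ? ? [].
have uA : u *m mxof e e A = complex.Re z *: u - complex.Im z *: v.
  apply/rowP => j; have /rowP/(_ j)/(congr1 (@complex.Re R)) := wA.
  rewrite !mxE (big_morph _ ReD erefl) => wAj.
  transitivity (complex.Re (z * w 0 j)); last first.
    by case: {wA wAj} z (w 0 j) => ? ? [].
  rewrite -{}wAj; apply: eq_bigr => k _; rewrite !mxE.
  by case: (w 0 k) => ? ? /=; rewrite mulr0 subr0.
have vA : v *m mxof e e A = complex.Im z *: u + complex.Re z *: v.
  apply/rowP => j; have /rowP/(_ j)/(congr1 (@complex.Im R)) := wA.
  rewrite !mxE (big_morph _ ImD erefl) => wAj.
  transitivity (complex.Im (z * w 0 j)); last first.
    by case: {wA wAj uA} z (w 0 j) => ? ? [? ?]; rewrite /= addrC.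
  rewrite -{}wAj; apply: eq_bigr => k _; rewrite !mxE.
  by case: (w 0 k) => ? ? /=; rewrite mulr0 add0r.
exists (vecof e u), (vecof e v); split.
- rewrite !vecof_eq0 // -negb_and; apply: contra w0.
  move=> /andP[/eqP u0 /eqP v0]; apply/eqP/rowP => j.
  have /rowP/(_ j) := u0; have /rowP/(_ j) := v0.
  by rewrite !mxE; case: (w 0 j) => ? ? /= -> ->.
- by rewrite (hom_vecof e eB) uA linearB !linearZ.
- by rewrite (hom_vecof e eB) vA linearD !linearZ.
Qed.

Lemma spectrum_nonempty A : {:V}%VS != 0%VS -> exists z, spectrum A z.
Proof.
rewrite -dimv_eq0 -lt0n => V0.
by apply: eigenvalue_closed; rewrite ?size_vbasis.
Qed.

End InnerProduct.

Section Rayleigh.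
Context (R : realType).

(** The complex numbers being algebraically closed, there is a complex
    eigenvalue, which is real by the pencil lemma with C = 1. *)
Lemma self_adjoint_eigenvalue (V : vectType R) ip (S : 'End(V)) :
  inner_product ip -> self_adjoint ip S -> {:V}%VS != 0%VS ->
  exists m, leigenvalue S m.
Proof.
move=> Hip HS /(spectrum_nonempty S)[z /spectrumP[p [q [pq0 Sp Sq]]]].
have b0 : complex.Im z = 0.
  apply: (pencil_eigenvalue_real (C := \1%VF) Hip HS _ _ pq0).
  - by move=> u v; rewrite !lfunE.
  - by move=> v /(ip_gt0 Hip); rewrite lfunE.
  - by rewrite !lfunE; exact: Sp.
  - by rewrite !lfunE; exact: Sq.
exists (complex.Re z); apply/leigenvalueP; move: Sp Sq.
rewrite b0 !scale0r subr0 add0r => Sp Sq.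
by case/orP: pq0 => ?; [exists p|exists q].
Qed.

(** Induction on the dimension: S has a real eigenvector w, and the orthogonal
    complement W of w is S-invariant, so the bound on W is the induction
    hypothesis for the restriction of S. A general v splits as a w + r with r in
    W, and the mixed terms vanish. *)
Lemma rayleigh_ge (V : vectType R) ip (S : 'End(V)) m :
  inner_product ip -> self_adjoint ip S ->
  (forall x, leigenvalue S x -> m <= x) ->
  forall v, m * ip v v <= ip (S v) v.
Proof.
move: {2}(\dim {:V}) (leqnn (\dim {:V})) => k.
elim: k V ip S => [|k IH] V ip S dimV Hip HS Hm v.
  move: dimV; rewrite leqn0 dimv_eq0 => /eqP V0.
  have : v \in 0%VS by rewrite -V0 memvf.
  by rewrite memv0 => /eqP ->; rewrite linear0 !(ip0l Hip) mulr0.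
have [/eqP V0|V0] := eqVneq {:V}%VS 0%VS.
  by apply: (IH V) => //; rewrite -dimv_eq0 in V0; rewrite (eqP V0).
have [x Sx] := self_adjoint_eigenvalue Hip HS V0.
have {V0} xm := Hm x Sx; case/leigenvalueP: Sx => w w0 Sw.
have ww := ip_gt0 Hip w0.
have lin : linear (fun u => ip u w : R^o).
  by move=> a u u'; rewrite (ip_linear Hip).
pose fL : {linear V -> R^o} :=
  HB.pack (fun u => ip u w : R^o) (GRing.isLinear.Build _ _ _ _ _ lin).
pose W := lker (linfun fL).
have inW u : (u \in W) = (ip u w == 0) by rewrite memv_ker lfunE.
have SW u : u \in W -> S u \in W.
  by rewrite !inW HS Sw (ipZr Hip) => /eqP ->; rewrite mulr0.
pose S' : 'End(subvs_of W) := linfun (vsproj W \o S \o vsval).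
have S'E (u : subvs_of W) : vsval (S' u) = S (vsval u).
  by rewrite lfunE /= vsprojK // SW // subvsP.
pose ip' (u v : subvs_of W) := ip (vsval u) (vsval v).
have Hip' : inner_product ip'.
  split=> [a u u' u''|u u'|u u0].
  - by rewrite /ip' linearP (ip_linear Hip).
  - exact: ip_sym Hip _ _.
  - by apply: (ip_gt0 Hip); rewrite -(inj_eq val_inj) in u0.
have HS' : self_adjoint ip' S' by move=> u u'; rewrite /ip' !S'E HS.
have dimW : (\dim {:subvs_of W} <= k)%N.
  have -> : \dim {:subvs_of W} = \dim W by rewrite dimvf.
  rewrite -ltnS; apply: leq_trans dimV; rewrite ltnNge.
  apply: contraL (isT) => dimVW.
  have /eqP WV : (W == {:V})%VS by rewrite eqEdim subvf.
  by move: (memvf w); rewrite -WV inW gt_eqF.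
have S'm y : leigenvalue S' y -> m <= y.
  move=> /leigenvalueP[u u0 /(congr1 vsval)]; rewrite S'E => Su.
  apply: Hm; apply/leigenvalueP; exists (vsval u); last by rewrite Su linearZ.
  by rewrite -(inj_eq val_inj) in u0.
pose a := ip v w / ip w w; pose r := v - a *: w.
have rw : ip r w = 0 by rewrite (ipBl Hip) (ipZl Hip) divfK ?subrr// gt_eqF.
have rW : r \in W by rewrite inW rw.
have := IH _ _ _ dimW Hip' HS' S'm (vsproj W r).
rewrite /ip' S'E vsprojK // => Hr.
have wr : ip w r = 0 by rewrite (ip_sym Hip).
have -> : v = a *: w + r by rewrite addrC subrK.
clearbody r.
have Srw : ip (S r) w = 0 by rewrite HS Sw (ipZr Hip) rw mulr0.
rewrite linearD linearZ /= Sw !(ipDl Hip, ipDr Hip, ipZl Hip, ipZr Hip).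
rewrite rw wr Srw !mulr0 !addr0 !add0r mulrDr lerD //.
rewrite [leRHS](_ : _ = x * (a * (a * ip w w))); last by ring.
by rewrite ler_wpM2r // mulrA mulr_ge0 ?(ltW ww) // -expr2 sqr_ge0.
Qed.

Lemma rayleigh_le (V : vectType R) ip (S : 'End(V)) m :
  inner_product ip -> self_adjoint ip S ->
  (forall x, leigenvalue S x -> x <= m) ->
  forall v, ip (S v) v <= m * ip v v.
Proof.
move=> Hip HS Hm v.
have HN : self_adjoint ip (- S)%VF.
  by move=> u w; rewrite !opp_lfunE (ipNl Hip) (ipNr Hip) HS.
have : - m * ip v v <= ip ((- S)%VF v) v.
  apply: rayleigh_ge => // x /leigenvalueP[w w0]; rewrite opp_lfunE => Sw.
  rewrite lerNl; apply: Hm; apply/leigenvalueP; exists w => //.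
  by rewrite scaleNr -Sw opprK.
by rewrite opp_lfunE (ipNl Hip) mulNr lerN2.
Qed.

End Rayleigh.

(** * The spectrum of the Robin-Robin operator *)

Section RobinRobin.
Context (R : realType) (V : vectType R) (ip : V -> V -> R).
Context (S1 S2 : 'End(V)) (g1 g2 t : R).
Hypotheses (Hip : inner_product ip).
Hypotheses (HS1 : self_adjoint ip S1) (HS2 : self_adjoint ip S2).
Hypotheses (g1_gt0 : 0 < g1) (g2_gt0 : 0 < g2).
Hypothesis S1_gt0 : forall v, v != 0 -> 0 < ip (S1 v) v.
Hypothesis S1_lt : forall v, v != 0 -> ip (S1 v) v < g2 * ip v v.
Hypothesis S2_ge : forall v, g1 * ip v v <= ip (S2 v) v.
Hypothesis S2_le : forall v, ip (S2 v) v <= t * ip (S1 v) v.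

Let lfE := (add_lfunE, opp_lfunE, scale_lfunE, id_lfunE).
Let ipE := (ipDl Hip, ipDr Hip, ipNl Hip, ipNr Hip, ipZl Hip, ipZr Hip).

Let S1_ge0 v : 0 <= ip (S1 v) v.
Proof.
by have [->|v0] := eqVneq v 0; [rewrite linear0 (ip0l Hip)|exact/ltW/S1_gt0].
Qed.

Let S1_le v : ip (S1 v) v <= g2 * ip v v.
Proof.
have [->|v0] := eqVneq v 0; last exact/ltW/S1_lt.
by rewrite linear0 (ip0l Hip) mulr0.
Qed.

Let S2_ge0 v : 0 <= ip (S2 v) v.
Proof. by apply: le_trans (S2_ge v); rewrite mulr_ge0 ?(ip_ge0 Hip) ?ltW. Qed.

Let X := (g1 *: \1 + S1)%VF.
Let D := (g2 *: \1 - S1)%VF.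
Let Y := (g2 *: \1 + S2)%VF.
Let Z := (S2 - g1 *: \1)%VF.

Let kX : lker X == 0%VS.
Proof.
apply: (lker0_definite Hip) => v v0; rewrite !lfE !ipE.
by rewrite addr_gt0 ?S1_gt0// mulr_gt0 ?(ip_gt0 Hip).
Qed.

Let kD : lker D == 0%VS.
Proof.
by apply: (lker0_definite Hip) => v v0; rewrite !lfE !ipE subr_gt0 S1_lt.
Qed.

Let kY : lker Y == 0%VS.
Proof.
apply: (lker0_definite Hip) => v v0; rewrite !lfE !ipE.
by rewrite ltr_pwDl ?S2_ge0// mulr_gt0 ?(ip_gt0 Hip).
Qed.

(** With v = Y w the form is (Z w, Y w), and Y = Z + (g1 + g2). *)
Lemma domain2_factor_ge0 v : 0 <= ip ((Z \o Y^-1)%VF v) v.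
Proof.
have [w ->] : exists w, v = Y w by exists (Y^-1%VF v); rewrite lker0_lfunVK.
rewrite comp_lfunE /= (lker0_lfunK kY).
have -> : ip (Z w) (Y w) = ip (Z w) (Z w) + (g1 + g2) * ip (Z w) w.
  by rewrite !lfE !ipE; ring.
have Zw_ge0 : 0 <= ip (Z w) w by rewrite !lfE !ipE subr_ge0.
by rewrite addr_ge0 ?(ip_ge0 Hip)// mulr_ge0// addr_ge0 ?ltW.
Qed.

(** With v = Y w, the difference of the two sides is a polynomial in S2,
    x (g2 + x)^2 - g2 (x - g1) (g2 + x) = g2 x^2 + x^3 + g1 g2 (g2 + x),
    each of whose terms is a nonnegative form because S2 is one. *)
Lemma domain2_factor_le v : g2 * ip ((Z \o Y^-1)%VF v) v <= ip (S2 v) v.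
Proof.
have [w ->] : exists w, v = Y w by exists (Y^-1%VF v); rewrite lker0_lfunVK.
rewrite comp_lfunE /= (lker0_lfunK kY) -subr_ge0.
have -> : ip (S2 (Y w)) (Y w) - g2 * ip (Z w) (Y w) =
    g2 * ip (S2 w) (S2 w) + ip (S2 (S2 w)) (S2 w)
    + g1 * g2 * (g2 * ip w w + ip (S2 w) w).
  have -> : S2 (Y w) = g2 *: S2 w + S2 (S2 w) by rewrite !lfE linearD linearZ.
  by rewrite !lfE !ipE -!(HS2 w) (HS2 (S2 w) w); ring.
by rewrite !(addr_ge0, mulr_ge0) ?(ip_ge0 Hip) ?S2_ge0 ?(ltW g1_gt0)
  ?(ltW g2_gt0).
Qed.

(** With v = D w, the difference of the two sides is
    g2 (g1 + x) (g2 - x) - x (g2 - x)^2 = g1 g2 (g2 - x) + x^2 (g2 - x),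
    and D = g2 - S1 is a nonnegative form, evaluated at w and at S1 w. *)
Lemma domain1_factor_ge v : ip (S1 v) v <= g2 * ip ((X \o D^-1)%VF v) v.
Proof.
have [w ->] : exists w, v = D w by exists (D^-1%VF v); rewrite lker0_lfunVK.
rewrite comp_lfunE /= (lker0_lfunK kD) -subr_ge0.
have -> : g2 * ip (X w) (D w) - ip (S1 (D w)) (D w) =
    g1 * g2 * (g2 * ip w w - ip (S1 w) w)
    + (g2 * ip (S1 w) (S1 w) - ip (S1 (S1 w)) (S1 w)).
  have -> : S1 (D w) = g2 *: S1 w - S1 (S1 w) by rewrite !lfE linearB linearZ.
  by rewrite !lfE !ipE -!(HS1 w) (HS1 (S1 w) w); ring.
by rewrite addr_ge0 ?mulr_ge0 ?subr_ge0 ?S1_le ?(ltW g1_gt0) ?(ltW g2_gt0).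
Qed.

(** J = D X^-1 maps an eigenvector of T = A J to one of the pencil (A, C), since
    C = X D^-1 inverts J. *)
Lemma robin_T_eigenvalue p q a b : (p != 0) || (q != 0) ->
  robin_T S1 S2 g1 g2 p = a *: p - b *: q ->
  robin_T S1 S2 g1 g2 q = b *: p + a *: q ->
  b = 0 /\ 0 <= a <= t.
Proof.
pose A := (Z \o Y^-1)%VF; pose C := (X \o D^-1)%VF.
pose J := (D \o X^-1)%VF.
have TE v : robin_T S1 S2 g1 g2 v = A (J v) by rewrite /robin_T !comp_lfunE.
have CJ v : C (J v) = v.
  by rewrite !comp_lfunE /= (lker0_lfunK kD) (lker0_lfunVK kX).
have J0 v : v != 0 -> J v != 0.
  by apply: contraNN => /eqP Jv; rewrite -(CJ v) Jv linear0.
(* Z and Y, and likewise X and D, differ by scalars and signs: they commute. *)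
have ZE v : Z v = Y v - (g1 + g2) *: v.
  rewrite !lfE scalerDl [g1 *: v + _]addrC opprD addrA.
  by rewrite [g2 *: v + _]addrC addrK.
have XE v : X v = (g1 + g2) *: v - D v.
  by rewrite !lfE scalerDl opprB addrACA subrr addr0.
have HA : self_adjoint ip A.
  apply: self_adjoint_ratio kY => [u v|u v|v].
  - by rewrite !lfE !ipE HS2.
  - by rewrite !lfE !ipE HS2.
  - by rewrite !ZE [Y (_ - _)]linearB /= [Y (_ *: _)]linearZ.
have HC : self_adjoint ip C.
  apply: self_adjoint_ratio kD => [u v|u v|v].
  - by rewrite !lfE !ipE HS1.
  - by rewrite !lfE !ipE HS1.
  - by rewrite !XE [D (_ - _)]linearB /= [D (_ *: _)]linearZ.
have C_gt0 v : v != 0 -> 0 < ip (C v) v.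
  move=> v0; rewrite -(pmulr_rgt0 _ g2_gt0).
  exact: lt_le_trans (S1_gt0 v0) (domain1_factor_ge v).
move=> pq0 Tp Tq.
have Ap : A (J p) = a *: C (J p) - b *: C (J q) by rewrite -TE !CJ.
have Aq : A (J q) = b *: C (J p) + a *: C (J q) by rewrite -TE !CJ.
have b0 := pencil_eigenvalue_real Hip HA HC C_gt0 _ Ap Aq.
have {}b0 : b = 0 by apply: b0; case/orP: pq0 => /J0 ->; rewrite ?orbT.
split=> //; move: Ap Aq; rewrite b0 !scale0r subr0 add0r => Ap Aq.
have [v v0 Av] : exists2 v, v != 0 & A v = a *: C v.
  by case/orP: pq0 => /J0 ?; [exists (J p)|exists (J q)].
have Cv := C_gt0 v v0.
have := domain2_factor_ge0 v; have := domain2_factor_le v.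
rewrite -/A Av !ipE pmulr_lge0 // => le ->.
rewrite andTb -(ler_pM2r Cv) -(ler_pM2l g2_gt0).
apply: (le_trans le); apply: le_trans (S2_le v) _.
have t_gt0 : 0 <= t.
  rewrite -(pmulr_lge0 _ (S1_gt0 v0)); exact: le_trans (S2_le v).
by rewrite [leRHS]mulrCA ler_wpM2l // domain1_factor_ge.
Qed.

Lemma robin_R_spectrum (theta : R) z : 0 < theta < 1 ->
  (1 - theta) * t <= 2 * theta ->
  spectrum (robin_R S1 S2 g1 g2 theta) z ->
  complex.Im z = 0 /\ - theta <= complex.Re z <= theta.
Proof.
move=> /andP[th0 th1] tth /spectrumP[p [q [pq0]]].
have om0 : 0 < 1 - theta by rewrite subr_gt0.
(* a + i b = (theta - z) / (1 - theta) is the matching eigenvalue of T. *)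
pose a := (theta - complex.Re z) / (1 - theta).
pose b := - complex.Im z / (1 - theta).
have aE : (1 - theta) * a = theta - complex.Re z
  by rewrite /a mulrC divfK ?gt_eqF.
have bE : (1 - theta) * b = - complex.Im z
  by rewrite /b mulrC divfK ?gt_eqF.
move=> Rp Rq.
have RE v : (1 - theta) *: robin_T S1 S2 g1 g2 v
    = theta *: v - robin_R S1 S2 g1 g2 theta v.
  by rewrite /robin_R !lfE opprB addrCA subrr addr0.
have om_inj := scalerI (lt0r_neq0 om0).
have [] // : b = 0 /\ 0 <= a <= t.
  apply: (robin_T_eigenvalue pq0); apply: om_inj.
  - by rewrite RE Rp scalerBr !scalerA aE bE scalerBl scaleNr opprD addrA.
  - by rewrite RE Rq scalerDr !scalerA aE bE scalerBl scaleNr opprD addrCA.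
move=> b0 /andP[a0 at_]; split.
  by apply/eqP; rewrite -oppr_eq0 -bE b0 mulr0.
have := ler_wpM2l (ltW om0) at_; have := mulr_ge0 (ltW om0) a0; lra.
Qed.

End RobinRobin.

(** * The L^2 inner product on the interface *)

Section TraceSpace.
Context (R : realType) (d : nat).
Notation pt := 'rV[R]_d.
Implicit Types (u : pt -> R) (U : set pt).

(** The Lipschitz condition refers to the Euclidean distance, whereas the topology
    of row vectors is given by the sup distance. *)
Definition elipschitz u :=
  exists L : R, forall x y, `|u x - u y| <= L * enorm (x - y).

Lemma edist_continuous (x : pt) : continuous (fun y : pt => enorm (x - y)).
Proof.
suff cdot : continuous (fun y : pt => dot (x - y) (x - y)).
  by move=> z; exact: (cvg_comp _ _ (cdot z) (@sqrt_continuous R _)).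
have -> : (fun y : pt => dot (x - y) (x - y)) =
    \sum_(k < d) (fun y : pt => (x ord0 k - y ord0 k) * (x ord0 k - y ord0 k)).
  by apply/funext => y; rewrite fct_sumE; apply: eq_bigr => k _; rewrite !mxE.
elim/big_ind: _ => [|f g cf cg|k _] z; first exact: cst_continuous.
- exact: (cvgD (cf z) (cg z)).
- have cxk : {for z, continuous (fun y : pt => x ord0 k - y ord0 k)}.
    by apply: continuousB; [exact: cst_continuous|exact: coord_continuous].
  exact: (cvgM cxk cxk).
Qed.

Lemma elipschitz_continuous u : elipschitz u -> continuous u.
Proof.
move=> [L uL]; suff ux (x : pt) : u y @[y --> x] --> u x by exact: ux.
have : L * enorm (x - y) @[y --> x] --> (0 : R).
  have -> : 0 = L * enorm (x - x) :> R.
    rewrite subrr /enorm /dot big1 ?sqrtr0 ?mulr0// => k _.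
    by rewrite mxE mulr0.
  have cL : {for x, continuous (fun _ : pt => L)} by exact: cst_continuous.
  have cE : {for x, continuous (fun y : pt => enorm (x - y))}.
    exact: edist_continuous.
  exact: (cvgM cL cE).
move=> /cvgrPdist_lt L0; have FF : Filter (nbhs x) := nbhs_filter x.
apply/(@cvgrPdist_lt _ _ _ (nbhs x)) => e e0; near=> y.
apply: (le_lt_trans (uL x y)); apply: (le_lt_trans (ler_norm _)).
by rewrite -normrN -sub0r; near: y; exact: L0.
Unshelve. all: by end_near. Qed.

Lemma open_borel U : open U -> measurable (U : set (borel R d)).
Proof. exact: sub_gen_smallest. Qed.

Lemma continuous_borel u D : continuous u ->
  measurable_fun D (u : borel R d -> R).
Proof.
move=> cu; apply: measurable_funTS.
apply: (measurability _ (RGenOpens.measurableE R)).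
move=> _ [_ [a [b ->] <-]]; rewrite setTI; apply: open_borel.
by move/continuousP : cu; apply; exact: interval_open.
Qed.

Lemma fe_span_elipschitz (N : nat) (b : 'I_N -> pt -> R) u :
  (forall j, elipschitz (b j)) -> fe_span b u -> elipschitz u.
Proof.
move=> /choice[L bL] [a ->]; exists (\sum_i `|a i| * L i) => x y.
rewrite -sumrB mulr_suml; apply: (le_trans (ler_norm_sum _ _ _)).
by apply: ler_sum => i _; rewrite -mulrBr normrM -mulrA ler_wpM2l.
Qed.

Section SquareIntegrable.
Context (area : {measure set (borel R d) -> \bar R}) (Gamma : set pt) (M : R).
Hypotheses (mG : measurable (Gamma : set (borel R d))).
Hypotheses (fG : (area Gamma < +oo)%E) (bG : forall x, Gamma x -> enorm x <= M).
Hypothesis area_gt0 : forall U, open U -> Gamma `&` U !=set0 ->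
  (0 < area (Gamma `&` U))%E.

Lemma elipschitz_bounded u : elipschitz u ->
  exists B, forall x, Gamma x -> `|u x| <= B.
Proof.
move=> [L uL]; exists (`|u 0| + `|L| * M) => x Gx.
have -> : u x = u 0 + (u x - u 0) by rewrite addrCA subrr addr0.
apply: (le_trans (ler_normD _ _)); rewrite lerD2l.
apply: (le_trans (uL x 0)); rewrite subr0.
apply: (@le_trans _ _ (`|L| * enorm x)).
  by rewrite ler_wpM2r ?sqrtr_ge0 ?ler_norm.
by rewrite ler_wpM2l ?bG.
Qed.

Lemma elipschitz_integrable u v : elipschitz u -> elipschitz v ->
  area.-integrable (Gamma : set (borel R d)) (EFin \o (fun x => u x * v x)).
Proof.
move=> lu lv; apply: measurable_bounded_integrable => //.
  by apply: measurable_funM; apply: continuous_borel;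
    exact: elipschitz_continuous.
have [B uB] := elipschitz_bounded lu; have [C vC] := elipschitz_bounded lv.
exists (B * C); split; first exact: num_real.
move=> x BCx y Gy; apply/ltW; apply: le_lt_trans BCx.
by rewrite normrM ler_pM ?uB ?vC.
Qed.

(** By continuity |u| stays above e = |u x| / 2 on a relatively open piece
    of Gamma around x, which has positive area. *)
Lemma elipschitz_l2_gt0 u x : elipschitz u -> Gamma x -> u x != 0 ->
  0 < l2 area Gamma u u.
Proof.
move=> lu Gx ux0; pose e := `|u x| / 2.
have e0 : 0 < e by rewrite divr_gt0 ?normr_gt0.
pose U := [set y | e < `|u y|].
have oU : open U.
  have cu : continuous (fun y => `|u y|).
    move=> y; apply: continuous_comp (@norm_continuous _ R^o _).
    exact: elipschitz_continuous.
  apply: (@open_comp _ _ (fun y => `|u y|) [set r | e < r]).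
    by move=> y _; exact: cu.
  exact: open_gt.
have Ux : U x by rewrite /U /= ltr_pdivrMr// ltr_pMr ?normr_gt0 ?ltr1n.
have mU := open_borel oU.
have GU0 : (0 < area (Gamma `&` U))%E by apply: area_gt0 => //; exists x.
have -> : Gamma = (Gamma `&` U) `|` (Gamma `&` ~` U).
  by rewrite -setIUr setUv setIT.
have mGU : measurable (Gamma `&` U : set (borel R d)) by exact: measurableI.
have mGUC : measurable (Gamma `&` ~` U : set (borel R d)).
  by apply: measurableI => //; exact: measurableC.
have iG := elipschitz_integrable lu lu.
rewrite /l2 Rintegral_setU //; first last.
- by apply/disj_setPS; rewrite setIACA setICr setI0.
- by rewrite -setIUr setUv setIT.
have le_cst : elipschitz (cst e).
  by exists 0 => y z; rewrite subrr normr0 mul0r.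
rewrite ltr_pwDl ?Rintegral_ge0 // => [|y _]; last by rewrite -expr2 sqr_ge0.
apply: (@lt_le_trans _ _ (\int[area]_(y in Gamma `&` U) (e * e))).
  rewrite Rintegral_cst //; apply: mulr_gt0; first exact: mulr_gt0.
  apply: fine_gt0; rewrite GU0 /=.
  by apply: le_lt_trans fG; rewrite le_measure ?inE // subIsetl.
apply: le_Rintegral => //.
- apply: integrableS (elipschitz_integrable le_cst le_cst) => //;
    exact: subIsetl.
- by apply: integrableS iG => //; exact: subIsetl.
- move=> y [_ /= /ltW ey]; rewrite -[leRHS]ger0_norm -?expr2 ?sqr_ge0 //.
  by rewrite normrX expr2 expr2 ler_pM // ltW.
Qed.

(** Lipschitz traces are bounded and measurable on a set of finite area, hence
    their products are integrable and the integral is bilinear; definiteness is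
    [elipschitz_l2_gt0]. *)
Lemma l2_inner_product (VG : vectType R) (tr : VG -> pt -> R) :
  (forall (a : R) (phi psi : VG) x,
     tr (a *: phi + psi) x = a * tr phi x + tr psi x) ->
  injective tr ->
  (forall phi, exists2 u, elipschitz u & tr phi = u \_ Gamma) ->
  inner_product (fun phi psi => l2 area Gamma (tr phi) (tr psi)).
Proof.
move=> tr_lin tr_inj tr_lip.
have trG phi : exists2 u, elipschitz u & forall x, Gamma x -> tr phi x = u x.
  by have [u lu ->] := tr_lip phi; exists u => // x Gx; rewrite patchE mem_set.
have tr_int phi psi :
    area.-integrable (Gamma : set (borel R d))
      (EFin \o (fun x => tr phi x * tr psi x)).
  have [u lu trE] := trG phi; have [v lv trF] := trG psi.
  apply: eq_integrable (elipschitz_integrable lu lv) => // x /set_mem Gx /=.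
  by rewrite trE // trF.
split=> [a u v w|u v|v v0].
- rewrite /l2 -RintegralZl // -RintegralD //; last first.
    by have := integrableZl mG a (tr_int u w); apply: eq_integrable.
  by apply: eq_Rintegral => x _; rewrite tr_lin mulrDl mulrA.
- by apply: eq_Rintegral => x _; rewrite mulrC.
- have [u lu trE] := tr_lip v.
  have -> : l2 area Gamma (tr v) (tr v) = l2 area Gamma u u.
    by apply: eq_Rintegral => x Gx; rewrite trE patchE Gx.
  have tr0 x : tr 0 x = 0.
    by have := tr_lin 1 0 0 x; rewrite scaler0 addr0; lra.
  have [x Gx ux] : exists2 x, Gamma x & u x != 0.
    apply: contrapT => /forall2NP u0; move/eqP : v0; apply; apply: tr_inj.
    apply/funext => x; rewrite tr0 trE patchE; case: ifPn => // /set_mem Gx.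
    by have [//|/negP] := u0 x; rewrite negbK => /eqP.
  exact: elipschitz_l2_gt0 lu Gx ux.
Qed.

End SquareIntegrable.

End TraceSpace.

(** * Dirichlet-to-Neumann operators on the trace space *)

Lemma DtN_self_adjoint (R : realType) (d : nat)
    (vol area : {measure set (borel R d) -> \bar R})
    (Omegai Gamma : set 'rV[R]_d) (N : nat) (b : 'I_N -> 'rV[R]_d -> R)
    (VG : vectType R) (tr : VG -> 'rV[R]_d -> R) (S : 'End(VG)) :
  is_DtN vol area Omegai Gamma b tr S ->
  self_adjoint (fun phi psi => l2 area Gamma (tr phi) (tr psi)) S.
Proof.
move=> [H [_ SH]] u v.
have l2C f g : l2 area Gamma f g = l2 area Gamma g f.
  by apply: eq_Rintegral => x _; rewrite mulrC.
rewrite [RHS]l2C !SH; apply: eq_Rintegral => x _.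
by apply: eq_bigr => k _; rewrite mulrC.
Qed.

Theorem theorem4p1
  (R : realType) (d : nat) (d_gt0 : (0 < d)%N)
  (vol area : {measure set (borel R d) -> \bar R})
  (Hvol : is_lebesgue vol) (Harea : is_surface_area area)
  (Omega Omega1 Omega2 Gamma : set 'rV[R]_d)
  (HOmega : is_domain Omega)
  (Hsplit : is_splitting area Omega Omega1 Omega2 Gamma)
  (* a family of discretizations, with mesh sizes h *)
  (I : Type) (h : I -> R) (h_gt0 : forall l, 0 < h l)
  (n : I -> nat) (K : forall l, 'I_(n l) -> set 'rV[R]_d)
  (Hmesh : forall l, is_mesh Omega (K l))
  (c : R) (c_gt0 : 0 < c)
  (Hqu : forall l, is_quasi_uniform c (h l) (K l))
  (N : I -> nat) (b : forall l, 'I_(N l) -> 'rV[R]_d -> R)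
  (Hfe : forall l, is_fe_space Omega (K l) (b l))
  (VG : I -> vectType R) (tr : forall l, VG l -> 'rV[R]_d -> R)
  (Htr : forall l, is_trace_space (b l) Gamma (tr l))
  (S1 S2 : forall l, 'End(VG l))
  (HS1 : forall l, is_DtN vol area Omega1 Gamma (b l) (tr l) (S1 l))
  (HS2 : forall l, is_DtN vol area Omega2 Gamma (b l) (tr l) (S2 l))
  (lmin1 lmin2 lmax1 lmax2 : I -> R)
  (Hlmin1 : forall l, is_smallest_eigenvalue (S1 l) (lmin1 l))
  (Hlmin2 : forall l, is_smallest_eigenvalue (S2 l) (lmin2 l))
  (Hlmax1 : forall l, is_largest_eigenvalue (S1 l) (lmax1 l))
  (Hlmax2 : forall l, is_largest_eigenvalue (S2 l) (lmax2 l))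
  (* s and t do not depend on the discretization *)
  (s t : R) (s_gt0 : 0 < s) (s_le1 : s <= 1) (t_ge1 : 1 <= t)
  (Hst : forall l (v : VG l),
     s * l2 area Gamma (tr l (S1 l v)) (tr l v)
       <= l2 area Gamma (tr l (S2 l v)) (tr l v)
     /\ l2 area Gamma (tr l (S2 l v)) (tr l v)
       <= t * l2 area Gamma (tr l (S1 l v)) (tr l v))
  (gamma1 gamma2 : I -> R)
  (gamma1_gt0 : forall l, 0 < gamma1 l)
  (gamma1_le : forall l, gamma1 l <= Num.min (lmin1 l) (lmin2 l))
  (gamma2_ge : forall l, 3 * Num.max (lmax1 l) (lmax2 l) <= gamma2 l)
  (theta : R) (Htheta : theta = (2 * t - 1) / (2 * t + 1)) :
  forall l,
    spectrum (robin_R (S1 l) (S2 l) (gamma1 l) (gamma2 l) theta)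
    `<=` [set real_complex R x |
            x in `[- ((2 * t - 1) / (2 * t + 1)), (2 * t - 1) / (2 * t + 1)]].
Proof.
move=> l z.
pose ip phi psi := l2 area Gamma (tr l phi) (tr l psi).
have [oO _ _ [M OM]] := HOmega.
have [_ _ GE fG area_gt0] := Hsplit.
have closed_borel (A : set 'rV[R]_d) :
    closed A -> measurable (A : set (borel R d)).
  by move=> /closed_openC/open_borel/measurableC; rewrite setCK.
have mG : measurable (Gamma : set (borel R d)).
  rewrite GE; apply: measurableI; first exact: open_borel.
  by apply: measurableI; apply: closed_borel; exact: closed_closure.
have bG x : Gamma x -> enorm x <= M by rewrite GE => -[/OM].
have Hip : inner_product ip.
  have [tr_lin tr_inj tr_range] := Htr l.
  apply: (l2_inner_product mG fG bG area_gt0 tr_lin tr_inj) => phi.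
  have [u uS uE] : fe_restr (b l) Gamma (tr l phi).
    by rewrite -tr_range; exists phi.
  exists u => //; apply: fe_span_elipschitz uS => j.
  by have [] := Hfe l j.
have HS1' : self_adjoint ip (S1 l) := DtN_self_adjoint (HS1 l).
have HS2' : self_adjoint ip (S2 l) := DtN_self_adjoint (HS2 l).
have g1 := gamma1_gt0 l.
have := gamma1_le l; rewrite le_min => /andP[g1m1 g1m2].
have [lmin1_eig lmin1_le] := Hlmin1 l; have [_ lmin2_le] := Hlmin2 l.
have [_ lmax1_ge] := Hlmax1 l.
have lmax1_gt0 : 0 < lmax1 l.
  by apply: lt_le_trans (lmax1_ge _ lmin1_eig); exact: lt_le_trans g1m1.
have lmax1_lt : lmax1 l < gamma2 l.
  apply: lt_le_trans (gamma2_ge l).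
  have : lmax1 l <= Num.max (lmax1 l) (lmax2 l) by rewrite le_max lexx.
  lra.
have t1 : 0 < 2 * t + 1 by lra.
have th : theta * (2 * t + 1) = 2 * t - 1 by rewrite Htheta divfK ?gt_eqF.
have th01 : 0 < theta < 1.
  by rewrite Htheta divr_gt0 ?ltr_pdivrMr //=; lra.
have tth : (1 - theta) * t <= 2 * theta.
  have om : (1 - theta) * (2 * t + 1) = 2 by rewrite mulrBl mul1r th; lra.
  by rewrite -(ler_pM2r t1) mulrAC om -mulrA th; lra.
move=> /(robin_R_spectrum Hip HS1' HS2' g1 _ _ _ _ _ th01 tth)[].
- exact: lt_trans lmax1_lt.
- move=> v v0; apply: lt_le_trans (rayleigh_ge Hip HS1' lmin1_le v).
  by rewrite mulr_gt0 ?(ip_gt0 Hip) //; exact: lt_le_trans g1m1.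
- move=> v v0; apply: le_lt_trans (rayleigh_le Hip HS1' lmax1_ge v) _.
  by rewrite ltr_pM2r ?(ip_gt0 Hip).
- move=> v; apply: le_trans (rayleigh_ge Hip HS2' lmin2_le v).
  by rewrite ler_wpM2r ?(ip_ge0 Hip).
- by move=> v; have [_] := Hst l v.
case: z => x y /= -> /andP[x_ge x_le]; exists x => //=.
by rewrite in_itv /= -Htheta x_ge.
Qed.
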